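(* Let $G$ be a finite simple graph. The following three statements are equivalent: (i) $G$ is an NSI graph, i.e., $G$ is the intersection graph of a family of balls in some real tree; (ii) $G$ is a proper-NSI graph, i.e., $G$ is the intersection graph of a family of balls in some real tree such that no ball of the family is fully contained in another ball of the family; (iii) $G$ is a unit-NSI graph, i.e., $G$ is the intersection graph of a family of balls in some real tree all having the same radius.
   Context: A real tree ($\mathbb{R}$-tree) is a metric space $(\mathcal{T},d)$ such that any two points $x,y\in\mathcal{T}$ are joined by a unique topological arc (image of a topological embedding of $[0,1]$ sending $0\mapsto x$, $1\mapsto y$), and this arc is a geodesic segment of length $d(x,y)$. The ball centered at $x\in\mathcal{T}$ with radius $r$ is $B(x,r)=\{y\in\mathcal{T}: d(x,y)\le r\}$. Given a family of sets $\mathcal{B}=\{B_v\}_{v\in V}$ indexed by a finite set $V$, its intersection graph is the graph with vertex set $V$ in which distinct $u,v$ are adjacent iff $B_u\cap B_v\neq\emptyset$; $G$ is the intersection graph of $\mathcal{B}$ if it is isomorphic to this graph. *)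

(* Defs.v *)
From HB Require Import structures.
From mathcomp Require Import all_boot all_order all_algebra.
From mathcomp Require Import all_classical all_reals all_analysis.

Set Implicit Arguments.
Unset Strict Implicit.
Unset Printing Implicit Defensive.

Import Order.TTheory GRing.Theory Num.Theory.
Import numFieldNormedType.Exports.

Local Open Scope classical_set_scope.
Local Open Scope ring_scope.

Record sgraph := SGraph {
  vertex :> finType;
  adj : rel vertex;
  adj_sym : symmetric adj;
  adj_irrefl : irreflexive adj
}.

Definition graph_iso (G H : sgraph) : Prop :=
  exists f : G -> H, bijective f /\ {mono f : u v / adj u v}.

Section IntersectionGraph.
Context {T : Type} {W : finType} (B : W -> set T).

Definition inter_adj : rel W :=
  fun u v => (u != v) && `[< B u `&` B v !=set0 >].

Lemma inter_adj_sym : symmetric inter_adj.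
Proof. by move=> u v; rewrite /inter_adj eq_sym setIC. Qed.

Lemma inter_adj_irrefl : irreflexive inter_adj.
Proof. by move=> u; rewrite /inter_adj eqxx. Qed.

Definition intersection_graph : sgraph :=
  SGraph inter_adj_sym inter_adj_irrefl.

End IntersectionGraph.

Section RealTree.
Context {R : realType} {T : metricType R}.

(* [f] is a topological embedding of the subspace [0, 1] of [R]: [g], restricted
   to the image of [f], is the continuous inverse of [f]. *)
Definition is_arc (x y : T) (A : set T) : Prop :=
  exists f : R -> T,
    [/\ {within `[0, 1], continuous f},
        exists g : T -> R,
          (forall t : R, `[0, 1]%classic t -> g (f t) = t) /\
          {within f @` `[0, 1], continuous g},
        f 0 = x, f 1 = y & A = f @` `[0, 1]].

Definition is_geodesic_segment (x y : T) (A : set T) : Prop :=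
  exists f : R -> T,
    [/\ forall s t : R, `[0, mdist x y]%classic s -> `[0, mdist x y]%classic t ->
          mdist (f s) (f t) = `|s - t|,
        f 0 = x, f (mdist x y) = y & A = f @` `[0, mdist x y]].

(* The library's [closed_ball] is the closure of the open ball, which in a
   general metric space can be smaller than this set. *)
Definition mball (x : T) (r : R) : set T := [set y | mdist x y <= r].

End RealTree.

(* An embedding of [0, 1] has distinct endpoints, so only pairs of distinct
   points are joined by arcs. *)
Definition is_real_tree (R : realType) (T : metricType R) : Prop :=
  forall x y : T, x <> y ->
    exists A : set T,
      [/\ is_arc x y A,
          forall A' : set T, is_arc x y A' -> A' = A &
          is_geodesic_segment x y A].

(* The balls of a family are given by centers [c] and radii [r]; radii are
   nonnegative, so that balls are nonempty. *)
Definition NSI_graph (R : realType) (G : sgraph) : Prop :=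
  exists (T : metricType R) (W : finType) (c : W -> T) (r : W -> R),
    [/\ is_real_tree T,
        forall w, 0 <= r w &
        graph_iso G (intersection_graph (fun w => mball (c w) (r w)))].

(* Containment is tested between distinct members of the indexed family, so a
   ball occurring twice counts as contained in another one. *)
Definition proper_NSI_graph (R : realType) (G : sgraph) : Prop :=
  exists (T : metricType R) (W : finType) (c : W -> T) (r : W -> R),
    [/\ is_real_tree T,
        forall w, 0 <= r w,
        forall u v : W, u <> v -> ~ (mball (c u) (r u) `<=` mball (c v) (r v)) &
        graph_iso G (intersection_graph (fun w => mball (c w) (r w)))].

Definition unit_NSI_graph (R : realType) (G : sgraph) : Prop :=
  exists (T : metricType R) (W : finType) (c : W -> T) (r : W -> R),
    [/\ is_real_tree T,
        forall w, 0 <= r w,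
        forall u v : W, r u = r v &
        graph_iso G (intersection_graph (fun w => mball (c w) (r w)))].

(* Main.v *)
(* From balls B(c_w, r_w) in a real tree, with M an upper bound of the radii,
   glue to each center c_w its own hair and move the center up the hair by
   M - r_w. Balls of radius M around the new centers meet exactly when the old
   balls meet, and the point at height M above a new center lies in no other
   new ball; so the new family is both unit and proper.
   That the glued space is a real tree is checked on a purely metric
   characterization of real trees: geodesics exist, and whenever z is between x
   and y, every w has z between x and w or between w and y. *)
From HB Require Import structures.
Require Import Defs.
From mathcomp Require Import all_boot all_order all_algebra.
From mathcomp Require Import all_classical all_reals all_analysis.
From mathcomp Require Import ring lra.

Set Implicit Arguments.
Unset Strict Implicit.
Unset Printing Implicit Defensive.

Import Order.TTheory GRing.Theory Num.Theory.
Import numFieldNormedType.Exports.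

Local Open Scope classical_set_scope.
Local Open Scope ring_scope.

(** * Paths and arcs in metric spaces *)

Lemma within_continuous_comp_image (U V W : topologicalType) (A : set U)
    (f : U -> V) (g : V -> W) :
  {within A, continuous f} -> {within f @` A, continuous g} ->
  {within A, continuous (g \o f)}.
Proof.
move=> /subspace_continuousP cf /subspace_continuousP cg.
apply/subspace_continuousP => x Ax.
move=> Q gQ; have fQ := cf x Ax _ (cg (f x) (imageP f Ax) Q gQ).
have {}fQ : nbhs x (fun y => A y -> (f @` A) (f y) -> Q (g (f y))) by exact: fQ.
suff : nbhs x (fun y => A y -> Q (g (f y))) by [].
by apply: filterS fQ => y yQ Ay; apply: yQ => //; exists y.
Qed.

Section MetricPaths.
Context {R : realType} {T : metricType R}.
Implicit Types (x y z p q w : T) (f g k : R -> T) (a b s t : R).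

Lemma within_lipschitz_continuous (A : set R) (C : R) k :
  (forall s t, A s -> A t -> mdist (k s) (k t) <= C * `|s - t|) ->
  {within A, continuous k}.
Proof.
move=> kC; apply/subspace_continuousP => s As.
apply/metricType_numDomainType.cvgrPdist_le => e e0.
(* As [C] may be zero or negative, it is enlarged to a positive constant that can serve as a
   divisor. *)
have C1 : 0 < `|C| + 1 by rewrite ltr_wpDl.
have near_s : nbhs s (fun t => `|s - t| < e / (`|C| + 1)).
  by exists (e / (`|C| + 1)) => //=; rewrite divr_gt0.
suff : nbhs s (fun t => A t -> mdist (k s) (k t) <= e) by [].
apply: filterS near_s => t st At.
apply: le_trans (kC _ _ As At) _.
apply: (@le_trans _ _ ((`|C| + 1) * `|s - t|)).
  by rewrite ler_wpM2r// (le_trans (ler_norm C))// lerDl.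
by rewrite mulrC -ler_pdivlMr// ltW.
Qed.

Lemma nonexpansive_continuous (phi : T -> R) :
  (forall x y, `|phi x - phi y| <= mdist x y) -> continuous phi.
Proof.
move=> phi1 x; apply/cvgrPdist_le => e e0.
apply/metricType_numDomainType.nbhs_mdistP; exists e => //= y xy.
by apply: le_trans (phi1 _ _) (ltW xy).
Qed.

(* The inverse of a continuous injection of a segment is continuous because
   the segment is compact and metric spaces are Hausdorff. *)
Lemma injective_path_is_arc a b k : a < b ->
  {within `[a, b], continuous k} ->
  (forall s t, a <= s <= b -> a <= t <= b -> k s = k t -> s = t) ->
  is_arc (k a) (k b) (k @` `[a, b]).
Proof.
move=> ab ck kI; pose h t := a + t * (b - a).
have ba : 0 < b - a by rewrite subr_gt0.
have h01 t : (`[0, 1]%classic t) = (`[a, b]%classic (h t)).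
  apply/propext; rewrite /= !in_itv/= /h; split => /andP[t0 t1].
    apply/andP; split; nra.
  apply/andP; split; nra.
have hE : h @` `[0, 1] = `[a, b]%classic.
  apply/seteqP; split => [_ [t t01 <-]|t tab]; first by rewrite -h01.
  have ht : h ((t - a) / (b - a)) = t.
    by rewrite /h -mulrA mulVf ?mulr1 ?gt_eqF// addrC subrK.
  by exists ((t - a) / (b - a)) => //; rewrite h01 ht.
have hI s t : h s = h t -> s = t.
  by move=> /addrI /mulIf; apply; rewrite gt_eqF.
have fE : (k \o h) @` `[0, 1] = k @` `[a, b] by rewrite -hE image_comp.
have cf : {within `[0, 1], continuous (k \o h)}.
  apply: within_continuous_comp_image; last by rewrite hE.
  apply: continuous_subspaceT => t; rewrite /h.
  by apply: cvgD; [exact: cvg_cst|apply: cvgMl; exact: cvg_id].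
have fI s t : `[0, 1]%classic s -> `[0, 1]%classic t -> k (h s) = k (h t) -> s = t.
  by rewrite !h01 /= !in_itv/= => sab tab /(kI _ _ sab tab)/hI.
exists (k \o h); split => //.
- have gP y : exists t, ((k \o h) @` `[0, 1]) y -> `[0, 1]%classic t /\ k (h t) = y.
    have [[t t01 <-]|ny] := pselect (((k \o h) @` `[0, 1]) y); first by exists t.
    by exists 0.
  have [g gE] := choice gP; exists g.
  have gK t : `[0, 1]%classic t -> g (k (h t)) = t.
    move=> t01; have [] := gE (k (h t)); first by exists t.
    by move=> gt01; apply: fI.
  split=> //; apply/continuous_closedP => C clC; apply/closed_subspaceP.
  (* On the arc, the preimage of [C] under [g] is this image of a compact set. *)
  exists ((k \o h) @` (`[0, 1] `&` C)).
    apply: (compact_closed (@metric_hausdorff _ T)).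
    apply: continuous_compact; last by apply: compact_closedI => //; exact: segment_compact.
    by apply: continuous_subspaceW cf => t [].
  apply/seteqP; split => y [].
    move=> [t [t01 Ct] <-] _; split; last by exists t.
    by have : C (g (k (h t))) by rewrite gK.
  move=> Cy [t t01 tE]; rewrite -tE in Cy *.
  have Ct : C (g (k (h t))) by exact: Cy.
  by split; exists t => //; split => //; rewrite -(gK t).
- by rewrite /= /h mul0r addr0.
- by rewrite /= /h mul1r addrC subrK.
Qed.

End MetricPaths.

(** * Metric characterization of real trees *)

Section RealTreeCharacterization.
Context {R : realType} {T : metricType R}.
Implicit Types (x y z p q w : T) (f g k : R -> T) (a b s t : R).

Definition btw x z y := mdist x y = mdist x z + mdist z y.

(** Unlike in [is_geodesic_segment], the parametrization is kept, so that geodesics can be reversed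
    and concatenated. *)
Definition geodesic x y f :=
  [/\ f 0 = x, f (mdist x y) = y &
    forall s t, 0 <= s <= mdist x y -> 0 <= t <= mdist x y ->
      mdist (f s) (f t) = `|s - t|].

Lemma btw_sym x z y : btw x z y -> btw y z x.
Proof. by rewrite /btw ![_ _ x]metric_sym [mdist y z]metric_sym addrC. Qed.

Lemma btwl x y : btw x x y.
Proof. by rewrite /btw mdistxx add0r. Qed.

Lemma geodesic_dist x y f t : geodesic x y f -> 0 <= t <= mdist x y ->
  mdist x (f t) = t.
Proof.
move=> [f0 _ fD] /[dup] tD /andP[t0 _].
by rewrite -[in LHS]f0 fD ?lexx ?mdist_ge0// sub0r normrN ger0_norm.
Qed.

Lemma geodesic_btw x y f t : geodesic x y f -> 0 <= t <= mdist x y ->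
  btw x (f t) y.
Proof.
move=> gf tD; rewrite /btw (geodesic_dist gf tD); case: gf => _ fy fD.
have D0 := mdist_ge0 x y.
have := fD t (mdist x y) tD; rewrite fy D0 lexx => /(_ isT) ->.
by move/andP: tD => [t0 tD]; rewrite distrC ger0_norm ?subr_ge0//; lra.
Qed.

Lemma geodesic_sym x y f :
  geodesic x y f -> geodesic y x (fun t => f (mdist x y - t)).
Proof.
move=> [f0 fy fD]; split.
- by rewrite subr0.
- by rewrite [mdist y x]metric_sym subrr.
- move=> s t; rewrite [mdist y x]metric_sym => /andP[s0 sD] /andP[t0 tD].
  rewrite fD; first by rewrite distrC; congr (`|_|); ring.
  + by apply/andP; split; lra.
  + by apply/andP; split; lra.
Qed.

(** By the triangle inequality at [z], the concatenation does not stretch distances. If it shortened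
    one, the route from [x] to [y] through the two points concerned would be shorter than
    [mdist x y]. *)
Lemma geodesic_cat x z y f g : btw x z y -> geodesic x z f -> geodesic z y g ->
  exists2 h, geodesic x y h & h (mdist x z) = z.
Proof.
move=> xzy [f0 fz fD] [g0 gy gD].
have xz0 := mdist_ge0 x z; have zy0 := mdist_ge0 z y.
pose h t := if t <= mdist x z then f t else g (t - mdist x z).
have hl t : t <= mdist x z -> h t = f t by rewrite /h => ->.
have hr t : mdist x z <= t -> h t = g (t - mdist x z).
  rewrite /h; case: ltgtP => // <- _; by rewrite fz subrr g0.
have hz : h (mdist x z) = z by rewrite hl.
have hx : h 0 = x by rewrite hl.
have hy : h (mdist x y) = y by rewrite xzy hr ?lerDl// addrC addKr.
have hup s t : 0 <= s <= t -> t <= mdist x y -> mdist (h s) (h t) <= t - s.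
  move=> /andP[s0 st]; rewrite xzy => tD.
  have [tz|zt] := leP t (mdist x z).
    rewrite !hl ?(le_trans st)// fD ?s0 ?(le_trans st)// ?(le_trans s0)//.
    by rewrite distrC ger0_norm// subr_ge0.
  have [zs|sz] := leP (mdist x z) s.
    rewrite !hr ?(le_trans zs)// gD; last 2 first.
    - by apply/andP; split; lra.
    - by apply/andP; split; lra.
    by rewrite distrC ger0_norm; lra.
  apply: le_trans (metric_triangle _ z _) _.
  have -> : mdist (h s) z = mdist x z - s.
    rewrite -[X in mdist _ X]fz hl ?ltW// fD; last 2 first.
    - by apply/andP; split; lra.
    - by apply/andP; split; lra.
    by rewrite distrC ger0_norm; lra.
  have -> : mdist z (h t) = t - mdist x z.
    rewrite -[X in mdist X _]g0 hr ?ltW// gD; last 2 first.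
    - by apply/andP; split; lra.
    - by apply/andP; split; lra.
    by rewrite distrC ger0_norm; lra.
  lra.
have hE s t : 0 <= s <= t -> t <= mdist x y -> mdist (h s) (h t) = t - s.
  move=> /[dup] s0t /andP[s0 st] tD; apply/eqP; rewrite eq_le hup//=.
  have := metric_triangle x (h s) y; have := metric_triangle (h s) (h t) y.
  have := hup 0 s; rewrite hx lexx s0 (le_trans st tD) => /(_ isT isT).
  have := hup t (mdist x y); rewrite hy tD (le_trans s0 st) lexx => /(_ isT isT).
  lra.
exists h => //; split => // s t /andP[s0 sD] /andP[t0 tD].
have [st|ts] := leP s t.
  by rewrite hE ?s0// distrC ger0_norm ?subr_ge0.
by rewrite metric_sym hE ?t0 ?(ltW ts)// ger0_norm// subr_ge0 ltW.
Qed.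

Lemma geodesic_is_arc x y f : x <> y -> geodesic x y f ->
  is_arc x y (f @` `[0, mdist x y]).
Proof.
move=> xy [f0 fy fD]; rewrite -[X in is_arc X]f0 -[X in is_arc _ X]fy.
apply: injective_path_is_arc.
- by rewrite mdist_gt0; apply/eqP.
- apply: (@within_lipschitz_continuous _ _ _ 1) => s t /=.
  by rewrite !in_itv/= mul1r => sD tD; rewrite fD.
- move=> s t sD tD fst; have := fD _ _ sD tD; rewrite fst mdistxx.
  by move/esym/normr0_eq0/eqP; rewrite subr_eq0 => /eqP.
Qed.

Definition geodesic_space := forall x y, exists f, geodesic x y f.

(** A point [z] strictly between [x] and [y] cuts a tree so that no [w] stays on the same side as
    both. Since only distances occur, the condition can be checked in the comb by computation. *)
Definition separating := forall x z y w, btw x z y -> btw x z w \/ btw w z y.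

(* The distance to [z], counted negatively on the side of [x], is continuous
   and vanishes only at [z]; hence a path from [x] to [y] meets [z]. *)
Lemma separating_path x z y (h : R -> T) : separating -> btw x z y ->
  {within `[0, 1], continuous h} -> h 0 = x -> h 1 = y ->
  exists2 t, 0 <= t <= 1 & h t = z.
Proof.
move=> sepT xzy ch h0 h1.
pose phi w := if `[< btw x z w >] then mdist z w else - mdist z w.
(* For [u] and [v] on different sides, [separating] puts [z] between them, so their signed distances
   differ by exactly [mdist u v]. *)
have phi1 u v : btw x z u -> ~ btw x z v -> `|mdist z u - - mdist z v| <= mdist u v.
  move=> xzu xzv; have [//|vzu] := sepT _ _ _ v xzu.
  rewrite [mdist u v]metric_sym vzu [mdist v z]metric_sym opprK ger0_norm 1?addrC//.
  by rewrite addr_ge0 ?mdist_ge0.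
have dz u v : `|mdist z u - mdist z v| <= mdist u v.
  rewrite ler_norml; have := metric_triangle z u v.
  have := metric_triangle z v u; rewrite [mdist v u]metric_sym => ? ?.
  by apply/andP; split; lra.
have cphi : continuous phi.
  apply: nonexpansive_continuous => u v; rewrite /phi.
  case: asboolP => xzu; case: asboolP => xzv //; first exact: phi1.
    by rewrite distrC [mdist u v]metric_sym; apply: phi1.
  by rewrite -opprD normrN; apply: dz.
have [||| t] := @IVT R (phi \o h) 0 1 0.
- exact: ler01.
- by apply: within_continuous_comp_image ch _; apply: continuous_subspaceT.
- have phix : phi (h 0) <= 0.
    rewrite h0 /phi; case: asboolP; last by rewrite oppr_le0 mdist_ge0.
    rewrite /btw mdistxx [mdist x z]metric_sym => zx.
    by have := mdist_ge0 z x; lra.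
  have phiy : 0 <= phi (h 1).
    by rewrite h1 /phi; case: asboolP => // _; exact: mdist_ge0.
  by rewrite ge_min phix/= le_max phiy orbT.
- rewrite in_itv/= => t01 phit; exists t => //; apply/esym/mdist_positivity.
  by move: phit; rewrite /phi; case: asboolP => _; lra.
Qed.

(** By [separating_path], every arc from [x] to [y] contains the geodesic; the intermediate value
    theorem shows that it contains nothing else. *)
Lemma separating_is_real_tree :
  geodesic_space -> separating -> is_real_tree T.
Proof.
move=> geoT sepT x y xy; have [f gf] := geoT x y.
exists (f @` `[0, mdist x y]); split.
- exact: geodesic_is_arc.
- move=> A' [h [ch [g [gK cg]] h0 h1 ->]].
  have sub : f @` `[0, mdist x y] `<=` h @` `[0, 1].
    move=> _ [s /= sD <-]; rewrite in_itv/= in sD.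
    have [t t01 ht] := separating_path sepT (geodesic_btw gf sD) ch h0 h1.
    by exists t => //=; rewrite in_itv.
  (* Along the geodesic, the arc parameter [g \o f] goes continuously from 0 to 1, hence takes the
     value [t]. *)
  apply/seteqP; split => // _ [t t01 <-].
  have cgf : {within `[0, mdist x y], continuous (g \o f)}.
    apply: within_continuous_comp_image; last exact: continuous_subspaceW cg.
    apply: (@within_lipschitz_continuous _ _ _ 1) => s u /=.
    by rewrite !in_itv/= mul1r; case: gf => _ _ fD sD uD; rewrite fD.
  have [||| s] := @IVT R (g \o f) 0 (mdist x y) t.
  + exact: mdist_ge0.
  + exact: cgf.
  + case: gf => f0 fy _; rewrite /= f0 fy -h0 -h1.
    rewrite !gK; try by rewrite /= in_itv/= lexx ler01.
    move: t01; rewrite /= in_itv/= => /andP[t0 t1].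
    by rewrite ge_min t0 le_max t1 orbT.
  + move=> sD /= gfs; exists s => //.
    have [u u01 hu] : (h @` `[0, 1]) (f s) by apply: sub; exists s.
    by rewrite -gfs -hu gK.
- by case: gf => f0 fy fD; exists f; split => // s t /=; rewrite !in_itv/=; apply: fD.
Qed.

Lemma real_tree_geodesic_space : is_real_tree T -> geodesic_space.
Proof.
move=> treeT x y; have [<-|xy] := pselect (x = y).
  exists (fun=> x); split => // s t; rewrite mdistxx -!eq_le.
  by move=> /eqP<- /eqP<-; rewrite subrr normr0.
have [A [_ _ [f [fD f0 fy _]]]] := treeT x y xy.
by exists f; split => // s t sD tD; apply: fD; rewrite /= in_itv.
Qed.

(* The geodesics from [w] to [x] and to [y] agree for the last time at
   parameter [t0]; going from [x] back to that point and then on to [y] is an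
   arc, hence it is the segment [x, y]. *)
Lemma real_tree_separating : is_real_tree T -> separating.
Proof.
move=> treeT x z y w xzy; have geoT := real_tree_geodesic_space treeT.
apply: contrapT => /not_orP[nxzw nwzy].
have xy : x <> y.
  move=> xy; apply: nxzw; rewrite (_ : z = x); first exact: btwl.
  apply/esym/mdist_positivity; move: xzy.
  by rewrite -xy /btw mdistxx [mdist z x]metric_sym; lra.
have [a ga] := geoT w x; have [b gb] := geoT w y.
case: (ga) (gb) => [a0 ax aD] [b0 bx bD].
have dx0 := mdist_ge0 w x; have dy0 := mdist_ge0 w y.
pose K := [set t | [/\ 0 <= t <= mdist w x, 0 <= t <= mdist w y & a t = b t]].
have K0 : K 0 by split; rewrite ?lexx ?dx0 ?dy0// a0 b0.
have Kub : has_sup K.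
  by split; [exists 0|exists (mdist w x) => t [/andP[]]].
pose t0 := sup K.
have Kle t : K t -> t <= t0 by move=> Kt; apply: sup_upper_bound Kub _ Kt.
have t00 : 0 <= t0 by exact: Kle.
have t0x : t0 <= mdist w x by apply: ge_sup; [exists 0|move=> t [/andP[]]].
have t0y : t0 <= mdist w y by apply: ge_sup; [exists 0|move=> t [_ /andP[]]].
(* The supremum is attained: some [t] in [K] is within [e / 2] of [t0], and each geodesic moves by
   less than [e / 2] in between. *)
have ab0 : a t0 = b t0.
  apply: mdist_positivity; apply/eqP; rewrite eq_le mdist_ge0 andbT.
  apply/ler_addgt0Pl => e e0; rewrite addr0.
  have [t Kt t0t] := sup_adherent (divr_gt0 e0 (ltr0n _ 2)) Kub.
  have tt0 := Kle _ Kt; case: Kt => tx ty abt.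
  apply: le_trans (metric_triangle _ (a t) _) _; rewrite {2}abt.
  rewrite aD ?t00// bD ?t00// [X in _ + X]distrC ger0_norm ?subr_ge0//.
  by rewrite -/t0 in t0t; lra.
(* Signed length from the branch point [a t0]: negative parameters lead back to [x] along [a],
   positive ones on to [y] along [b]. *)
pose k v := if v <= 0 then a (t0 - v) else b (t0 + v).
pose al := t0 - mdist w x; pose be := mdist w y - t0.
have al0 : al <= 0 by rewrite /al; lra.
have be0 : 0 <= be by rewrite /be; lra.
have kl v : al <= v -> v <= 0 -> 0 <= t0 - v <= mdist w x /\ k v = a (t0 - v).
  by rewrite /al /k => alv v0; rewrite v0; split=> //; apply/andP; split; lra.
have kr v : 0 <= v -> v <= be -> 0 <= t0 + v <= mdist w y /\ k v = b (t0 + v).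
  rewrite /be /k => v0 vbe; split; first by apply/andP; split; lra.
  case: ltgtP v0 => // <- _; by rewrite subr0 addr0.
have kal : k al = x by have [_ ->] := kl al (lexx _) al0; rewrite subKr.
have kbe : k be = y by have [_ ->] := kr be be0 (lexx _); rewrite addrC subrK.
have albe : al < be.
  rewrite lt_neqAle (le_trans al0 be0) andbT; apply/eqP => E.
  by apply: xy; rewrite -kal -kbe E.
have kup s t : al <= s -> s <= t -> t <= be -> mdist (k s) (k t) <= t - s.
  move=> als st tbe; have [tz|zt] := leP t 0.
    have [sD ->] := kl s als (le_trans st tz).
    have [tD ->] := kl t (le_trans als st) tz.
    by rewrite aD// ger0_norm; lra.
  have [tD ->] := kr t (ltW zt) tbe; have [zs|sz] := leP 0 s.
    have [sD ->] := kr s zs (le_trans st tbe).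
    by rewrite bD// distrC ger0_norm; lra.
  have [sD ->] := kl s als (ltW sz).
  apply: le_trans (metric_triangle _ (a t0) _) _; rewrite {2}ab0.
  by rewrite aD ?t00// bD ?t00// ger0_norm 1?distrC 1?ger0_norm; lra.
have kinj s t : al <= s -> s < t -> t <= be -> k s <> k t.
  move=> als st tbe; have [tz|zt] := leP t 0.
    have [sD ->] := kl s als (le_trans (ltW st) tz).
    have [tD ->] := kl t (le_trans als (ltW st)) tz.
    by move=> E; have := aD _ _ sD tD; rewrite E mdistxx ger0_norm; lra.
  have [tD ->] := kr t (ltW zt) tbe; have [zs|sz] := leP 0 s.
    have [sD ->] := kr s zs (le_trans (ltW st) tbe).
    by move=> E; have := bD _ _ sD tD; rewrite E mdistxx distrC ger0_norm; lra.
  (* A point common to both branches has a single distance to [w], so its two parameters agree and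
     give an element of [K] above [t0]. *)
  have [sD ->] := kl s als (ltW sz) => E.
  have ts : t0 - s = t0 + t.
    by rewrite -(geodesic_dist ga sD) -(geodesic_dist gb tD) E.
  have Kt : K (t0 + t) by split => //; [rewrite -ts|rewrite -E ts].
  by have := Kle _ Kt; lra.
have arck : is_arc x y (k @` `[al, be]).
  rewrite -kal -kbe; apply: injective_path_is_arc => //.
    apply: (@within_lipschitz_continuous _ _ _ 1) => s t /=.
    rewrite !in_itv/= mul1r => /andP[als sbe] /andP[alt tbe].
    have [st|ts] := leP s t.
      by rewrite distrC ger0_norm ?subr_ge0// kup.
    by rewrite metric_sym ger0_norm ?subr_ge0 ?kup// ltW.
  move=> s t /andP[als sbe] /andP[alt tbe] kst.
  have [st|ts|//] := ltgtP s t; first by have := kinj s t als st tbe.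
  by have := kinj t s alt ts sbe; rewrite kst.
(* A geodesic through [z] is an arc too, so by uniqueness [z] lies on [k], that is, on one of the
   geodesics from [w]. *)
have [f gf] := geoT x z; have [g gg] := geoT z y.
have [h gh hz] := geodesic_cat xzy gf gg.
have [A [_ unqA _]] := treeT x y xy.
have : (k @` `[al, be]) z.
  rewrite (unqA _ arck) -(unqA _ (geodesic_is_arc xy gh)).
  by exists (mdist x z) => //=; rewrite in_itv/= mdist_ge0 xzy lerDl mdist_ge0.
move=> [v /=]; rewrite in_itv/= => /andP[alv vbe] kvz.
have [v0|v0] := leP v 0.
  have [vD kv] := kl v alv v0; apply: nxzw; apply: btw_sym.
  by rewrite -kvz kv; apply: geodesic_btw ga vD.
have [vD kv] := kr v (ltW v0) vbe; apply: nwzy.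
by rewrite -kvz kv; apply: geodesic_btw gb vD.
Qed.

End RealTreeCharacterization.

(* [T] with a line glued by its origin at each point: [(x, s)] is the point at
   height [s] on the line through [x], and [(x, 0)] is [x] itself. *)
Definition comb (R : realType) (T : metricType R) : Type := (T * R)%type.

(** * The comb over a metric space, and its tree structure *)

Section Comb.
Context {R : realType} {T : metricType R}.
Implicit Types (u v w z : comb T).

HB.instance Definition _ := Choice.on (comb T).

Definition comb_dist u v : R :=
  if u.1 == v.1 then `|u.2 - v.2| else `|u.2| + `|v.2| + mdist u.1 v.1.

Lemma comb_dist_eq u v : u.1 = v.1 -> comb_dist u v = `|u.2 - v.2|.
Proof. by rewrite /comb_dist => ->; rewrite eqxx. Qed.

Lemma comb_dist_neq u v : u.1 <> v.1 ->
  comb_dist u v = `|u.2| + `|v.2| + mdist u.1 v.1.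
Proof. by move=> /eqP/negPf uv; rewrite /comb_dist uv. Qed.

Let comb_distxx u : comb_dist u u = 0.
Proof. by rewrite comb_dist_eq// subrr normr0. Qed.

Let comb_dist_positivity u v : comb_dist u v = 0 -> u = v.
Proof.
case: u v => [x s] [y t]; have [xy|xy] := pselect (x = y).
  rewrite comb_dist_eq//= => /normr0_eq0/eqP; rewrite subr_eq0 => /eqP ->.
  by rewrite xy.
rewrite comb_dist_neq//= => d0.
have := normr_ge0 s; have := normr_ge0 t => ? ?.
have d1 : 0 < mdist x y by rewrite mdist_gt0; apply/eqP.
by exfalso; clear xy; lra.
Qed.

Let comb_dist_sym u v : comb_dist u v = comb_dist v u.
Proof.
have [uv|uv] := pselect (u.1 = v.1).
  by rewrite !comb_dist_eq// distrC.
by rewrite !comb_dist_neq ?[mdist v.1 _]metric_sym 1?[`|v.2| + _]addrC//; exact: nesym.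
Qed.

Let comb_dist_triangle v u w : comb_dist u w <= comb_dist u v + comb_dist v w.
Proof.
have nuv := ler_distD 0 u.2 v.2; rewrite subr0 sub0r normrN in nuv.
have nuw := ler_distD 0 u.2 w.2; rewrite subr0 sub0r normrN in nuw.
have v0 := normr_ge0 v.2.
have uvv : `|u.2| <= `|u.2 - v.2| + `|v.2|.
  by have := ler_normD (u.2 - v.2) v.2; rewrite subrK.
have wvv : `|w.2| <= `|v.2 - w.2| + `|v.2|.
  by have := ler_normD (w.2 - v.2) v.2; rewrite subrK [`|w.2 - _|]distrC.
have uvw := ler_distD v.2 u.2 w.2.
have tri := metric_triangle u.1 v.1 w.1.
have duv := mdist_ge0 u.1 v.1; have dvw := mdist_ge0 v.1 w.1.
(* Exactly two equalities among the three are contradictory; the other cases are linear in the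
   inequalities collected above. *)
have [uw|uw] := pselect (u.1 = w.1); have [uv|uv] := pselect (u.1 = v.1);
  have [vw|vw] := pselect (v.1 = w.1);
  rewrite ?(comb_dist_eq uw) ?(comb_dist_eq uv) ?(comb_dist_eq vw)
    ?(comb_dist_neq uw) ?(comb_dist_neq uv) ?(comb_dist_neq vw);
  rewrite ?uv ?vw; first [exfalso; congruence | clear uw uv vw; lra].
Qed.

HB.instance Definition _ := isMetric.Build R (comb T)
  comb_distxx comb_dist_positivity comb_dist_sym comb_dist_triangle.

Lemma comb_mdist_eq u v : u.1 = v.1 -> mdist u v = `|u.2 - v.2|.
Proof. exact: comb_dist_eq. Qed.

Lemma comb_mdist_neq u v : u.1 <> v.1 ->
  mdist u v = `|u.2| + `|v.2| + mdist u.1 v.1.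
Proof. exact: comb_dist_neq. Qed.

Lemma comb_mdist0 (x y : T) : mdist ((x, 0) : comb T) (y, 0) = mdist x y.
Proof.
have [->|xy] := pselect (x = y); first by rewrite !mdistxx.
by rewrite comb_mdist_neq//= normr0 !add0r.
Qed.

Lemma comb_geodesic_vertical (x : T) (s t : R) :
  exists f, geodesic ((x, s) : comb T) (x, t) f.
Proof.
have [st|ts] := leP s t.
  exists (fun a => (x, s + a)); split => [||a b _ _].
  - by rewrite addr0.
  - by rewrite comb_mdist_eq//= distrC ger0_norm ?subr_ge0// addrC subrK.
  - by rewrite comb_mdist_eq//=; congr (`|_|); ring.
exists (fun a => (x, s - a)); split => [||a b _ _].
- by rewrite subr0.
- by rewrite comb_mdist_eq//= gtr0_norm ?subr_gt0// subKr.
- by rewrite comb_mdist_eq//= distrC; congr (`|_|); ring.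
Qed.

(** Points on different lines are joined by going to height 0, then across a copy of a geodesic of
    [T], then along the second line. *)
Lemma comb_geodesic_space :
  geodesic_space (T := T) -> geodesic_space (T := comb T).
Proof.
move=> geoT [x s] [y t]; have [<-|xy] := pselect (x = y).
  exact: comb_geodesic_vertical.
have [f [f0 fy fD]] := geoT x y.
have [g gg] := comb_geodesic_vertical x s 0.
have [h gh] := comb_geodesic_vertical y 0 t.
have gf : geodesic ((x, 0) : comb T) (y, 0) (fun a => (f a, 0)).
  split; rewrite ?comb_mdist0 ?f0 ?fy// => a b aD bD.
  by rewrite comb_mdist0 fD.
have xt : btw ((x, 0) : comb T) (y, 0) (y, t).
  rewrite /btw comb_mdist0 comb_mdist_neq// comb_mdist_eq//=.
  by rewrite normr0 sub0r normrN; ring.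
have [i gi _] := geodesic_cat xt gf gh.
have st : btw ((x, s) : comb T) (x, 0) (y, t).
  rewrite /btw comb_mdist_neq// comb_mdist_eq// comb_mdist_neq//=.
  by rewrite normr0 subr0; ring.
by have [j gj _] := geodesic_cat st gg gi; exists j.
Qed.

Let line_btw (a b c : R) : `|a - c| = `|a - b| + `|b - c| <->
  a <= b <= c \/ c <= b <= a.
Proof.
split.
  have [ab|ba] := leP a b; have [bc|cb] := leP b c.
  - by left.
  - rewrite (ltW cb) /= => abc; right; move: abc.
    by case: (ger0P (a - c)); case: (ger0P (a - b)); case: (ger0P (b - c)) => *; lra.
  - rewrite (ltW ba) andbT => abc; right; move: abc.
    by case: (ger0P (a - c)); case: (ger0P (a - b)); case: (ger0P (b - c)) => *; lra.
  - by right; rewrite !ltW.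
case: (ger0P (a - c)); case: (ger0P (a - b)); case: (ger0P (b - c));
by move=> ? ? ? [/andP[? ?]|/andP[? ?]]; lra.
Qed.

(** [d] lies on one side of [b], and whichever of [a] and [c] is on the other side is cut off from
    it. *)
Let line_separating (a b c d : R) : `|a - c| = `|a - b| + `|b - c| ->
  `|a - d| = `|a - b| + `|b - d| \/ `|d - c| = `|d - b| + `|b - c|.
Proof.
rewrite !line_btw => -[] /andP[p q]; have [bd|/ltW db] := leP b d.
- by left; left; rewrite p.
- by right; left; rewrite db q.
- by right; right; rewrite p.
- by left; right; rewrite db q.
Qed.

(** Leaving the line of [x] means passing its origin, and [z] is on the way there. So [z] cuts [x]
    off from any [w] on another line, and a [w] on the same line reduces to [line_separating]. *)
Let comb_separating_same (x z y w : comb T) : z.1 = x.1 -> z.1 <> y.1 ->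
  btw x z y -> btw x z w \/ btw w z y.
Proof.
move=> zx zy; have xy : x.1 <> y.1 by congruence.
rewrite /btw (comb_mdist_neq xy) (comb_mdist_eq (esym zx)) (comb_mdist_neq zy).
rewrite zx => xzy; have [zw|zw] := pselect (z.1 = w.1).
  have xw : x.1 = w.1 by congruence.
  have wz := esym zw; have wy : w.1 <> y.1 by congruence.
  rewrite (comb_mdist_eq xw) (comb_mdist_eq zw) (comb_mdist_eq wz).
  rewrite (comb_mdist_neq wy) -xw.
  (* Seen from this line, [y] lies behind the origin, so height 0 stands in for it. *)
  have xz0 : `|x.2 - 0| = `|x.2 - z.2| + `|z.2 - 0|.
    by rewrite !subr0; clear zx zy xy zw xw wz wy; lra.
  have [->|] := line_separating w.2 xz0; first by left.
  by rewrite !subr0 => ->; right; ring.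
have xw : x.1 <> w.1 by congruence.
left; rewrite (comb_mdist_neq xw) (comb_mdist_neq zw) zx.
by clear zx zy xy zw xw; lra.
Qed.

(** The cases are whether [z] shares its line with [x] and with [y]; only when it shares neither
    does the hypothesis on [T] enter. *)
Lemma comb_separating : separating (T := T) -> separating (T := comb T).
Proof.
move=> sepT x z y w xzy.
have [zx|zx] := pselect (z.1 = x.1); have [zy|zy] := pselect (z.1 = y.1).
- have xy : x.1 = y.1 by congruence.
  move: xzy; rewrite /btw.
  rewrite (comb_mdist_eq xy) (comb_mdist_eq (esym zx)) (comb_mdist_eq zy) => xzy.
  have [zw|zw] := pselect (z.1 = w.1).
    have xw : x.1 = w.1 by congruence.
    have wz := esym zw; have wy : w.1 = y.1 by congruence.
    rewrite (comb_mdist_eq xw) (comb_mdist_eq zw) (comb_mdist_eq wz).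
    by rewrite (comb_mdist_eq wy); exact: line_separating.
  have xw : x.1 <> w.1 by congruence.
  have wz := nesym zw; have wy : w.1 <> y.1 by congruence.
  rewrite (comb_mdist_neq xw) (comb_mdist_neq zw) (comb_mdist_neq wz).
  rewrite (comb_mdist_neq wy) -zx -zy.
  (* Here [w] is on another line, so again height 0 stands in for it. *)
  have := line_separating 0 xzy; rewrite !subr0 !sub0r !normrN => -[E|E].
    by left; rewrite E; ring.
  by right; rewrite E; ring.
- exact: comb_separating_same.
- have [|] := comb_separating_same w zy zx (btw_sym xzy).
    by right; apply: btw_sym.
  by left; apply: btw_sym.
(* A detour through the line of [z] is strictly longer unless [z] is at height 0 with its base point
   between two distinct base points. *)
- have tri := metric_triangle x.1 z.1 y.1.
  have dxz : 0 < mdist x.1 z.1 by rewrite mdist_gt0; apply/eqP => /esym.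
  have dzy : 0 < mdist z.1 y.1 by rewrite mdist_gt0; apply/eqP.
  have x0 := normr_ge0 x.2; have z0 := normr_ge0 z.2; have y0 := normr_ge0 y.2.
  move: xzy; rewrite /btw (comb_mdist_neq (nesym zx)) (comb_mdist_neq zy).
  have [xy|xy] := pselect (x.1 = y.1).
    rewrite (comb_mdist_eq xy) => xzy; have nxy := ler_normB x.2 y.2.
    by exfalso; clear zx zy xy; lra.
  rewrite (comb_mdist_neq xy) => xzy.
  have z20 : `|z.2| = 0 by clear zx zy xy; lra.
  have btw1 : btw x.1 z.1 y.1 by rewrite /btw; clear zx zy xy; lra.
  rewrite z20; have [zw|zw] := pselect (z.1 = w.1).
    have xw : x.1 <> w.1 by congruence.
    left; rewrite (comb_mdist_neq xw) (comb_mdist_eq zw) -zw.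
    by move/eqP: z20; rewrite normr_eq0 => /eqP ->; rewrite sub0r normrN; ring.
  rewrite (comb_mdist_neq zw) (comb_mdist_neq (nesym zw)) z20.
  have [xzw|wzy] := sepT _ _ _ w.1 btw1; [left|right].
    have xw : x.1 <> w.1.
      by move=> xw; move: xzw; rewrite -xw /btw mdistxx [mdist z.1 _]metric_sym; clear xw zx zy xy zw; lra.
    by rewrite (comb_mdist_neq xw) xzw; ring.
  have wy : w.1 <> y.1.
    by move=> wy; move: wzy; rewrite wy /btw mdistxx [mdist y.1 z.1]metric_sym; clear wy zx zy xy zw; lra.
  by rewrite (comb_mdist_neq wy) wzy; ring.
Qed.

Lemma comb_real_tree : is_real_tree T -> is_real_tree (comb T).
Proof.
move=> treeT; apply: separating_is_real_tree.
  exact: comb_geodesic_space (real_tree_geodesic_space treeT).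
exact: comb_separating (real_tree_separating treeT).
Qed.

End Comb.

(** * Intersections of balls and the resulting graphs *)

Lemma mball_meet (R : realType) (T : metricType R) (x y : T) (r s : R) :
  geodesic_space (T := T) -> 0 <= r -> 0 <= s ->
  mball x r `&` mball y s !=set0 <-> mdist x y <= r + s.
Proof.
move=> geoT r0 s0; rewrite /mball; split.
  move=> [z [/= xz yz]]; apply: le_trans (metric_triangle x z y) _.
  by rewrite [mdist z y]metric_sym lerD.
move=> xyrs; have [f gf] := geoT x y; have [xyr|rxy] := leP (mdist x y) r.
  by exists y; split => //=; rewrite mdistxx.
have rD : 0 <= r <= mdist x y by rewrite r0 ltW.
(* The point at distance [r] from [x] on the geodesic is left at distance [mdist x y - r] from
   [y]. *)
exists (f r); split => /=; first by rewrite (geodesic_dist gf rD).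
have := geodesic_btw gf rD; rewrite /btw (geodesic_dist gf rD) [mdist y _]metric_sym.
by move=> E; rewrite E lerD2l in xyrs.
Qed.

(** By [mball_meet], both sides compare a distance with a sum of radii. If [x <> y], raising the
    centers adds [a + b] to both; if [x = y], both comparisons hold outright. *)
Lemma comb_mball_meet (R : realType) (T : metricType R) (x y : T) (r s a b : R) :
  is_real_tree T -> 0 <= r -> 0 <= s -> 0 <= a -> 0 <= b ->
  mball ((x, a) : comb T) (r + a) `&` mball ((y, b) : comb T) (s + b) !=set0 <->
  mball x r `&` mball y s !=set0.
Proof.
move=> treeT r0 s0 a0 b0; have geoT := real_tree_geodesic_space treeT.
rewrite !mball_meet ?addr_ge0//; last exact: comb_geodesic_space.
have [<-|xy] := pselect (x = y).
  rewrite comb_mdist_eq// mdistxx addr_ge0//; split => // _.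
  by have := ler_normB a b; rewrite (ger0_norm a0) (ger0_norm b0) /=; lra.
rewrite comb_mdist_neq//= (ger0_norm a0) (ger0_norm b0).
by rewrite addrC addrACA lerD2r.
Qed.

Lemma graph_iso_inter (T T' : Type) (W : finType) (G : sgraph)
    (B : W -> set T) (B' : W -> set T') :
  (forall u v, B' u `&` B' v !=set0 <-> B u `&` B v !=set0) ->
  graph_iso G (intersection_graph B) -> graph_iso G (intersection_graph B').
Proof.
move=> BB' [f [fbij fadj]]; exists f; split => // u v; rewrite -fadj /=.
by rewrite /inter_adj; congr (_ && _); apply/asboolP/asboolP => /BB'.
Qed.

(* Hairs at distinct heights separate balls with a common center, which the
   comb, having one line per point, could not give distinct hairs. *)
Lemma NSI_graph_injective (R : realType) (G : sgraph) : NSI_graph R G ->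
  exists (T : metricType R) (W : finType) (c : W -> T) (r : W -> R),
    [/\ is_real_tree T, injective c, forall w, 0 <= r w &
        graph_iso G (intersection_graph (fun w => mball (c w) (r w)))].
Proof.
move=> [T [W [c [r [treeT r0 isoG]]]]].
pose a (w : W) : R := (enum_rank w)%:R.
exists (comb T), W, (fun w => (c w, a w)), (fun w => r w + a w); split.
- exact: comb_real_tree.
- move=> u v [_ /eqP]; rewrite eqr_nat => /eqP/ord_inj; exact: enum_rank_inj.
- by move=> w; rewrite addr_ge0// ler0n.
- apply: graph_iso_inter isoG => u v.
  by apply: comb_mball_meet; rewrite ?ler0n.
Qed.

Lemma NSI_graph_unit_proper (R : realType) (G : sgraph) : NSI_graph R G ->
  exists (T : metricType R) (W : finType) (c : W -> T) (M : R),
    [/\ is_real_tree T, 0 <= M,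
        forall u v, u <> v -> ~ (mball (c u) M `<=` mball (c v) M) &
        graph_iso G (intersection_graph (fun w => mball (c w) M))].
Proof.
move=> /NSI_graph_injective[T [W [c [r [treeT cI r0 isoG]]]]].
(* Since the radii are nonnegative, their sum bounds each of them, and it makes sense for empty [W]
   as well. *)
pose M := \sum_(w : W) r w.
have rM w : r w <= M.
  by rewrite /M (bigD1 w)//= lerDl sumr_ge0.
have M0 : 0 <= M by rewrite sumr_ge0.
have a0 w : 0 <= M - r w by rewrite subr_ge0.
exists (comb T), W, (fun w => (c w, M - r w)), M; split => //.
- exact: comb_real_tree.
(* The witness is at distance exactly [M] above the new center of [u]. As [c] is injective, the
   center of [v] is on another line, so its distance to the witness exceeds the witness height,
   which is at least [M]. *)
- move=> u v uv /(_ ((c u, M - r u + M) : comb T)); rewrite /mball /=.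
  have cuv : c v <> c u by move/cI/esym.
  rewrite comb_mdist_eq//= opprD addNKr normrN ger0_norm// comb_mdist_neq//=.
  rewrite (ger0_norm (a0 v)) (ger0_norm (addr_ge0 (a0 u) M0)) => /(_ (lexx M)).
  have cuv0 : 0 < mdist (c v) (c u) by rewrite mdist_gt0; apply/eqP.
  have := a0 u; have := a0 v; clear cuv uv; lra.
- apply: graph_iso_inter isoG => u v.
  rewrite -(comb_mball_meet _ _ treeT (r0 u) (r0 v) (a0 u) (a0 v)).
  by rewrite ![r _ + _]addrC !subrK.
Qed.

Theorem theorem1 (R : realType) (G : sgraph) :
  (NSI_graph R G <-> proper_NSI_graph R G) /\
  (proper_NSI_graph R G <-> unit_NSI_graph R G).
Proof.
have proper_NSI : proper_NSI_graph R G -> NSI_graph R G.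
  by move=> [T [W [c [r [? ? _ ?]]]]]; exists T, W, c, r.
have unit_NSI : unit_NSI_graph R G -> NSI_graph R G.
  by move=> [T [W [c [r [? ? _ ?]]]]]; exists T, W, c, r.
have NSI_proper : NSI_graph R G -> proper_NSI_graph R G.
  move=> /NSI_graph_unit_proper[T [W [c [M [? ? ? ?]]]]].
  by exists T, W, c, (fun=> M).
have NSI_unit : NSI_graph R G -> unit_NSI_graph R G.
  move=> /NSI_graph_unit_proper[T [W [c [M [? ? ? ?]]]]].
  by exists T, W, c, (fun=> M).
by split; split; auto.
Qed.
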